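(* Let $f_{0,0}(x)=f_{1,0}(x)=\frac{x}{2}$ and $f_{0,1}(x)=f_{1,1}(x)=\frac{x+1}{2}$ for $x\in[0,1]$, and let $g_{i,j}:[0,1]\to[0,1]$, $i,j\in\{0,1\}$, be maps such that $\{g_{i,0},g_{i,1}\}$ is a compatible system for each $i\in\{0,1\}$. Let $(\varphi_0,\varphi_1)$ be the pair of increasing continuous maps $\varphi_0,\varphi_1:[0,1]\to[0,1]$ solving $$g_{i,j}(\varphi_j(x))=\varphi_i(f_{i,j}(x)),\qquad x\in[0,1],\ i,j\in\{0,1\}.$$ If $$\prod_{i,j\in\{0,1\}}\|g_{i,j}\|_{\mathrm{Lip}}<\frac1{16},$$ then both $\varphi_0$ and $\varphi_1$ are singular.
   Context: For $h:[0,1]\to\mathbb{R}$, $\|h\|_{\mathrm{Lip}}=\sup\left\{\frac{|h(x)-h(y)|}{|x-y|}: x\ne y\right\}$. A function $\varphi$ on $[0,1]$ is called singular if $\varphi'(x)=0$ for Lebesgue-a.e. $x\in(0,1)$. ''Increasing'' is meant in the non-strict sense. A comparison function is an increasing map $\phi:[0,\infty)\to[0,\infty)$ such that $\lim_{n\to\infty}\phi^n(t)=0$ for every $t>0$ ($\phi^n$ is the $n$-fold iterate). A map $h:[0,1]\to[0,1]$ is a $\phi$-contraction if $|h(x)-h(y)|\le\phi(|x-y|)$ for all $x,y\in[0,1]$. A pair $\{h_0,h_1\}$ of maps on $[0,1]$ is a compatible system with comparison function $\phi$ if $h_0,h_1$ are strictly increasing $\phi$-contractions and $0=h_0(0)<h_0(1)=h_1(0)<h_1(1)=1$.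 As a standing convention, all the maps $f_{i,j}$ and $g_{i,j}$ are $\phi$-contractions for one common comparison function $\phi$. The solution $(\varphi_0,\varphi_1)$ is constructed as follows. For $i_1,\dots,i_n\in\{0,1\}$ and $h\in\{f,g\}$ let $I^h_i(i_1,\dots,i_n)$ be the closed interval with endpoints $h_{i,i_1}\circ h_{i_1,i_2}\circ\cdots\circ h_{i_{n-1},i_n}(0)$ and $h_{i,i_1}\circ\cdots\circ h_{i_{n-1},i_n}(1)$. For $x_n\in\{0,1\}$ put $\varphi_i(f_{i,i_1}\circ\cdots\circ f_{i_{n-1},i_n}(x_n))=g_{i,i_1}\circ\cdots\circ g_{i_{n-1},i_n}(x_n)$; for any other $x\in[0,1]$ there is a unique sequence $(i_n)_n$ with $x\in I^f_i(i_1,\dots,i_n)$ for all $n$, and $\varphi_i(x)$ is the unique point of $\bigcap_{n\ge1}I^g_i(i_1,\dots,i_n)$. It is known that this is well-defined and that $(\varphi_0,\varphi_1)$ is the unique pair of increasing continuous maps $[0,1]\to[0,1]$ satisfying $g_{i,j}\circ\varphi_j=\varphi_i\circ f_{i,j}$ for all $i,j\in\{0,1\}$. *)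

(* Defs.v *)
From HB Require Import structures.
From mathcomp Require Import all_boot all_order all_algebra.
From mathcomp Require Import all_classical all_reals all_analysis.

Set Implicit Arguments.
Unset Strict Implicit.
Unset Printing Implicit Defensive.

Import Order.TTheory GRing.Theory Num.Theory.
Import numFieldNormedType.Exports.

Local Open Scope classical_set_scope.
Local Open Scope ring_scope.

(* Functions on [0,1] (resp. [0,+oo[) are total functions R -> R of which only
   the values on that interval are ever constrained or used. *)

(* Valued in \bar R, so that an unbounded family of slopes gives +oo. *)
Definition lip_norm (R : realType) (h : R -> R) : \bar R :=
  ereal_sup [set q : \bar R | exists x y : R,
    [/\ x \in `[0, 1], y \in `[0, 1], x != y &
        q = (`|h x - h y| / `|x - y|)%:E]].

Definition unit_map (R : realType) (h : R -> R) : Prop :=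
  forall x, x \in `[0, 1] -> h x \in `[0, 1].

Definition increasing01 (R : realType) (h : R -> R) : Prop :=
  forall x y, x \in `[0, 1] -> y \in `[0, 1] -> x <= y -> h x <= h y.

Definition strictly_increasing01 (R : realType) (h : R -> R) : Prop :=
  forall x y, x \in `[0, 1] -> y \in `[0, 1] -> x < y -> h x < h y.

Definition singular (R : realType) (h : R -> R) : Prop :=
  {ae @lebesgue_measure R, forall x : R,
    x \in `]0, 1[ -> derivable h x 1 /\ h^`()%classic x = 0}.

Definition comparison_function (R : realType) (phi : R -> R) : Prop :=
  [/\ forall t, 0 <= t -> 0 <= phi t,
      forall s t, 0 <= s -> s <= t -> phi s <= phi t &
      forall t, 0 < t -> (fun n : nat => iter n phi t) @ \oo --> (0 : R)].

Definition phi_contraction (R : realType) (phi h : R -> R) : Prop :=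
  unit_map h /\
  forall x y, x \in `[0, 1] -> y \in `[0, 1] -> `|h x - h y| <= phi `|x - y|.

Definition compatible_system (R : realType) (phi h0 h1 : R -> R) : Prop :=
  [/\ strictly_increasing01 h0 /\ phi_contraction phi h0,
      strictly_increasing01 h1 /\ phi_contraction phi h1 &
      [/\ h0 0 = 0, 0 < h0 1, h0 1 = h1 0, h1 0 < h1 1 & h1 1 = 1]].

(* Main.v *)
(* For small s > 0 the moments Q_i(n) = sum_k (2^n |phi_i(I_(n,k))|)^s over the
   dyadic intervals I_(n,k) of level n satisfy the matrix recursion
   Q_i(n+1) <= sum_j (2 L_ij)^s Q_j(n) with L_ij = ||g_ij||_Lip.  At s = 0 the
   matrix is twice a stochastic one, and prod 2 L_ij < 1 says that the logarithmic
   derivative of its spectral radius is negative there; so for small s the radius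
   is < 2 and Q_i(n) = O((2 theta)^n) with theta < 1.  By Markov's inequality the
   proportion of dyadic intervals with slope > c^n (for some c < 1) is then
   summable in n, and Borel-Cantelli, applied to these intervals enlarged by their
   neighbours, gives phi_i' = 0 almost everywhere directly, without Lebesgue's
   theorem on the differentiability of monotone functions. *)
Require Import Defs.
From HB Require Import structures.
From mathcomp Require Import all_boot all_order all_algebra.
From mathcomp Require Import all_classical all_reals all_analysis.
From mathcomp Require Import ring lra.

Import Order.TTheory GRing.Theory Num.Theory.
Import numFieldNormedType.Exports.

Local Open Scope classical_set_scope.
Local Open Scope ring_scope.

(** * Exponential sums at small exponents and a positive subeigenvector *)

(** At [s = 0] the sum equals 2 and has derivative [p + q < 0]. The bound [expR x <= (1 - x)^-1] for
    [x < 1] turns this into an explicit range of [s]. *)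
Lemma expR_add_lt2 (R : realType) (p q : R) : p + q < 0 ->
  exists2 s0 : R, 0 < s0 &
    forall s, 0 < s <= s0 -> expR (s * p) + expR (s * q) < 2.
Proof.
move=> pq0.
have expR_le (x : R) : x < 1 -> expR x <= (1 - x)^-1.
  move=> x1; rewrite -[leLHS]invrK -expRN lef_pV2 ?posrE ?expR_gt0 ?subr_gt0//.
  exact: expR_ge1Dx.
pose M := `|p| + `|q| + 1; pose d := - (p + q).
have d0 : 0 < d by rewrite oppr_gt0.
have M0 : 0 < M by rewrite ltr_wpDl// addr_ge0.
have [p1 p2 q1 q2] : [/\ p < M, - M < p, q < M & - M < q].
  rewrite /M; have := ler_norm p; have := ler_norm (- p); have := ler_norm q.
  have := ler_norm (- q); rewrite !normrN.
  have := normr_ge0 p; have := normr_ge0 q.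
  by move=> *; split; lra.
have D0 : 0 < 3 * M ^+ 2 + 2 * d * M.
  by rewrite addr_gt0// !mulr_gt0// exprn_gt0.
(* The term [2 * d * M] forces [s * M < 1], so that both denominators are positive; the term
   [3 * M ^+ 2] dominates the product [p * q]. *)
exists (d / (3 * M ^+ 2 + 2 * d * M)); first exact: divr_gt0.
move=> s /andP[s0 ss0].
have sM : s * (3 * M ^+ 2 + 2 * d * M) <= d by rewrite -ler_pdivlMr.
have sM20 : 0 < s * M ^+ 2 by rewrite mulr_gt0// exprn_gt0.
have sM1 : s * M < 1.
  have : 0 < d * (1 - s * M) by nra.
  by rewrite pmulr_rgt0// subr_gt0.
have sp1 : s * p < 1 by nra.
have sq1 : s * q < 1 by nra.
(* Multiplied by [s], this is what remains of [(1 - s * p)^-1 + (1 - s * q)^-1 < 2] once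
   denominators are cleared. *)
have pqM : 2 * s * (- (p * q)) < d.
  have h1 : - (p * q) <= M ^+ 2 by nra.
  have h2 : s * (- (p * q)) <= s * M ^+ 2 by rewrite ler_wpM2l// ltW.
  have h4 : 0 < s * (2 * d * M) by rewrite !mulr_gt0.
  nra.
have {}pqM : s * (2 * s * (- (p * q))) < s * d by rewrite ltr_pM2l.
apply: (@le_lt_trans _ _ ((1 - s * p)^-1 + (1 - s * q)^-1)).
  by apply: lerD; exact: expR_le.
have a0 : 0 < 1 - s * p by rewrite subr_gt0.
have b0 : 0 < 1 - s * q by rewrite subr_gt0.
rewrite -[X in X + _]mul1r -[X in _ + X]mul1r addf_div ?gt_eqF//.
rewrite ltr_pdivrMr ?mulr_gt0//.
rewrite /d in pqM; nra.
Qed.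

(* [e ^ u] with [u = (b10 + b11 - b00 - b01) / 2] equalizes the two row sums of
   the exponents, so that both are half of the negative total. *)
Lemma subeigenvector (R : realType) (B : 'I_2 -> 'I_2 -> R) :
  (forall i j, 0 < B i j) -> \prod_(i < 2) \prod_(j < 2) B i j < 1 ->
  exists s theta : R, exists v : 'I_2 -> R,
    [/\ 0 < s, 0 < theta < 1, forall i, 0 < v i &
        forall i, \sum_(j < 2) B i j `^ s * v j <= 2 * theta * v i].
Proof.
move=> B0.
have ord1 : lift ord0 ord0 = 1 :> 'I_2 by apply/val_inj.
rewrite !big_ord_recl !big_ord0 !mulr1 ord1 => prodB.
pose b i j := ln (B i j).
have BE i j s : B i j `^ s = expR (s * b i j).
  by rewrite /powR gt_eqF.
have sumb : b 0 0 + b 0 1 + b 1 0 + b 1 1 < 0.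
  rewrite /b -!lnM ?posrE ?mulr_gt0//.
  by rewrite -ln1 ltr_ln ?posrE ?mulr_gt0// -mulrA.
pose u := (b 1 0 + b 1 1 - b 0 0 - b 0 1) / 2.
have [s1 s10 hs1] : exists2 s0 : R, 0 < s0 & forall s, 0 < s <= s0 ->
    expR (s * b 0 0) + expR (s * (b 0 1 + u)) < 2.
  by apply: expR_add_lt2; rewrite /u; lra.
have [s2 s20 hs2] : exists2 s0 : R, 0 < s0 & forall s, 0 < s <= s0 ->
    expR (s * (b 1 0 - u)) + expR (s * b 1 1) < 2.
  by apply: expR_add_lt2; rewrite /u; lra.
pose s := Num.min s1 s2.
have s0 : 0 < s by rewrite lt_min s10.
have {}hs1 := hs1 s; have {}hs2 := hs2 s.
have {}hs1 : expR (s * b 0 0) + expR (s * (b 0 1 + u)) < 2.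
  by apply: hs1; rewrite s0 ge_min lexx.
have {}hs2 : expR (s * (b 1 0 - u)) + expR (s * b 1 1) < 2.
  by apply: hs2; rewrite s0 ge_min lexx orbT.
set r1 := (X in X < 2) in hs1; set r2 := (X in X < 2) in hs2.
(* With weights 1 and [expR (s * u)], row 0 sums to [r1] and row 1 to [r2 * expR (s * u)]; both [r1]
   and [r2] are below 2. *)
exists s, (Num.max r1 r2 / 2), (fun i => if i == 0 then 1 else expR (s * u)).
have r10 : 0 < r1 by rewrite addr_gt0// expR_gt0.
split=> //.
- rewrite divr_gt0//= ?lt_max ?r10//.
  by rewrite ltr_pdivrMr// mul1r gt_max hs1.
- by move=> i; case: ifP => // _; exact: expR_gt0.
- have r2E : 2 * (Num.max r1 r2 / 2) = Num.max r1 r2 by rewrite mulrC divfK.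
  have h i : (i == 0) || (i == 1 :> 'I_2) by case: i => [[|[|]]].
  move=> i; rewrite !big_ord_recl !big_ord0 addr0 ord1 r2E/=.
  have /orP[/eqP->|/eqP->] := h i => /=; rewrite !BE mulr1.
  + by rewrite -expRD -mulrDr mulr1 le_max lexx.
  + rewrite -[X in X + _]mulr1 -[X in _ * X + _](@mulVf _ (expR (s * u))) ?gt_eqF ?expR_gt0//.
    rewrite mulrA -mulrDl -expRN -expRD -mulrBr.
    by rewrite ler_pM2r ?expR_gt0// le_max lexx orbT.
Qed.

(** * Dyadic increments and vanishing derivatives *)

Definition dyadic_increment {R : realType} (h : R -> R) (n k : nat) : R :=
  h (k.+1%:R / 2 ^+ n) - h (k%:R / 2 ^+ n).

Lemma dyadic01 (R : realType) (n k : nat) : (k <= 2 ^ n)%N ->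
  k%:R / 2 ^+ n \in `[(0 : R), 1].
Proof.
move=> kn; rewrite in_itv/= divr_ge0 ?exprn_ge0//=.
by rewrite ler_pdivrMr ?exprn_gt0// mul1r -natrX ler_nat.
Qed.

Lemma dyadic_increment_ge0 (R : realType) (h : R -> R) (n k : nat) :
  increasing01 h -> (k < 2 ^ n)%N -> 0 <= dyadic_increment h n k.
Proof.
move=> hi kn; rewrite subr_ge0; apply: hi.
- by apply: dyadic01; exact: ltnW.
- exact: dyadic01.
- by rewrite ler_pM2r ?invr_gt0 ?exprn_gt0// ler_nat.
Qed.

Lemma dyadic_scale (R : realType) (t : R) : 0 < t -> t <= 1 ->
  exists n : nat, 2 ^- n.+1 < t <= 2 ^- n.
Proof.
move=> t0 t1.
have [m mt] : exists m, 2 ^- m < t.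
  have [N _ hN] := near_infty_natSinv_expn_lt (PosNum t0).
  by exists N; have := hN N (leqnn N); rewrite /= mul1r.
have ex : exists m, 2 ^- m < t by exists m.
case: (ex_minnP ex) => -[|n] nt min_n.
  by move: nt; rewrite expr0 invr1 ltNge t1.
exists n; rewrite nt/= leNgt; apply/negP => /min_n.
by rewrite ltnn.
Qed.

(* A point at distance at most [2 ^- n] of [x] lies in the dyadic interval of
   level [n] of [x] or in one of its two neighbours. *)
Lemma dyadic_oscillation (R : realType) (h : R -> R) (n : nat) (d x y : R) :
  increasing01 h -> 2 * 2 ^- n <= x -> 2 * 2 ^- n <= 1 - x ->
  `|y - x| <= 2 ^- n ->
  (forall k, (k < 2 ^ n)%N ->
     (k%:R - 1) / 2 ^+ n <= x <= (k%:R + 2) / 2 ^+ n ->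
     dyadic_increment h n k <= d) ->
  `|h y - h x| <= 3 * d.
Proof.
move=> hi x0 x1 xy hd.
have p0 : 0 < 2 ^+ n :> R by rewrite exprn_gt0.
have [k /andP[kx xk]] : exists k : nat, k%:R <= 2 ^+ n * x < k%:R + 1.
  exists (Num.truncn (2 ^+ n * x)); rewrite natr1 truncn_itv//.
  by rewrite mulr_ge0 ?(ltW p0)// (le_trans _ x0)// mulr_ge0// invr_ge0 ltW.
have X0 : 2 <= 2 ^+ n * x by rewrite mulrC -ler_pdivrMr.
have X1 : 2 ^+ n * x + 2 <= 2 ^+ n.
  move: x1; rewrite ler_pdivrMr// mulrBl mul1r mulrC; lra.
have [XY1 XY2] : 2 ^+ n * y <= 2 ^+ n * x + 1 /\ 2 ^+ n * x - 1 <= 2 ^+ n * y.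
  move: xy; rewrite ler_norml -[2 ^- n]mul1r lerNl !ler_pdivlMr//.
  by move=> /andP[? ?]; split; nra.
have k2 : (k.+2 <= 2 ^ n)%N.
  by rewrite -(ler_nat R) natrX -[k.+2]addn2 natrD; lra.
have k1 : (0 < k)%N by rewrite -(ltr_nat R); lra.
(* The margins around [x] keep both neighbours inside [0,1]. The indices [l], [l.+1], [l.+2] are the
   left neighbour, the interval of [x] and the right neighbour; [h x] and [h y] both lie between the
   values of [h] at the two ends of this triple. *)
have [l kE] : exists l, k = l.+1 by exists k.-1; rewrite prednK.
have kr : k%:R = l%:R + 1 :> R by rewrite kE -natr1.
have l1 : 0 <= l%:R :> R by [].
have ab z : 2 ^+ n * x - 1 <= 2 ^+ n * z <= 2 ^+ n * x + 1 ->
    h (l%:R / 2 ^+ n) <= h z <= h (l.+3%:R / 2 ^+ n).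
  move=> /andP[z1 z2].
  have lz : l%:R / 2 ^+ n <= z by rewrite ler_pdivrMr// [z * _]mulrC; lra.
  have zl : z <= l.+3%:R / 2 ^+ n.
    rewrite ler_pdivlMr// [z * _]mulrC -[l.+3]addn3 natrD.
    by lra.
  have ln : l%:R / 2 ^+ n \in `[(0 : R), 1].
    by apply: dyadic01; rewrite (leq_trans _ k2)// kE ltnW// ltnW.
  have l3n : l.+3%:R / 2 ^+ n \in `[(0 : R), 1].
    by apply: dyadic01; rewrite -kE.
  have zI : z \in `[0, 1].
    rewrite in_itv/=; move: ln l3n; rewrite !in_itv/=.
    by move=> /andP[l0 _] /andP[_ l3]; rewrite (le_trans l0)//= (le_trans zl).
  by rewrite !hi.
have /andP[hx1 hx2] : h (l%:R / 2 ^+ n) <= h x <= h (l.+3%:R / 2 ^+ n).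
  by apply: ab; apply/andP; split; lra.
have /andP[hy1 hy2] : h (l%:R / 2 ^+ n) <= h y <= h (l.+3%:R / 2 ^+ n).
  by apply: ab; apply/andP; split; lra.
have inc j : (l <= j <= l.+2)%N -> dyadic_increment h n j <= d.
  move=> /andP[lj jl]; apply: hd.
    by rewrite (leq_ltn_trans jl)// -kE.
  rewrite ler_pdivrMr// ler_pdivlMr// ![x * _]mulrC.
  move: lj jl; rewrite -!(ler_nat R) -[l.+2]addn2 natrD => lj jl.
  by apply/andP; split; lra.
have := inc l.+2; have := inc l.+1; have := inc l.
rewrite !leqnn leqnSn andbT /dyadic_increment => /(_ (leqW (leqnSn l))) i0.
move=> /(_ (leqnSn _)) i1 /(_ (leqW (leqnSn l))) i2.
by rewrite ler_norml; apply/andP; split; lra.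
Qed.

(** For a step [t] of size between [2 ^- n.+1] and [2 ^- n], three neighbouring increments bound the
    change of [h], so the difference quotient is at most [6 * c ^+ n]. *)
Lemma derive0_of_dyadic (R : realType) (h : R -> R) (c x : R) (N : nat) :
  increasing01 h -> 0 <= c < 1 -> x \in `]0, 1[ ->
  (forall n, (N <= n)%N -> forall k, (k < 2 ^ n)%N ->
     (k%:R - 1) / 2 ^+ n <= x <= (k%:R + 2) / 2 ^+ n ->
     2 ^+ n * dyadic_increment h n k <= c ^+ n) ->
  derivable h x 1 /\ h^`()%classic x = 0.
Proof.
move=> hi /andP[c0 c1]; rewrite in_itv/= => /andP[x0 x1] hc.
suff cv : t^-1 *: ((h \o shift x) (t *: 1) - h x) @[t --> 0^'] --> (0 : R).
  split; first by apply/cvg_ex; exists 0.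
  by rewrite derive1E /derive; apply: cvg_lim.
apply/cvgrPdist_le => e e0.
(* The 6 is 3 intervals times the factor 2 in [2 ^- n <= 2 * |t|]. *)
have e60 : 0 < e / 6 by rewrite divr_gt0.
have [M1 _ hM1] : \forall n \near \oo, c ^+ n <= e / 6.
  have : (GRing.exp c : R ^nat) @ \oo --> 0 by apply: cvg_expr; rewrite ger0_norm.
  move/cvgrPdist_le => /(_ _ e60); apply: filterS => n.
  by rewrite sub0r normrN; apply: le_trans; exact: ler_norm.
have m0 : 0 < Num.min x (1 - x) / 2 by rewrite divr_gt0// lt_min x0 subr_gt0.
have [M2 _ hM2] := near_infty_natSinv_expn_lt (PosNum m0).
(* Beyond [N] the slopes are controlled, beyond [M1] one has [c ^+ n <= e / 6], and beyond [M2] the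
   neighbours of the interval of [x] stay in [0,1]. *)
pose M := maxn N (maxn M1 M2).
have NM : (N <= M)%N by rewrite leq_maxl.
have M1M : (M1 <= M)%N by rewrite !leq_max leqnn orbT.
have M2M : (M2 <= M)%N by rewrite !leq_max leqnn !orbT.
have M0 : 0 < 2 ^- M :> R by rewrite invr_gt0 exprn_gt0.
near=> t.
have t0 : t != 0 by near: t; exact: nbhs_dnbhs_neq.
have tM : `|t| <= 2 ^- M.
  by near: t; exact: dnbhs0_le.
have [n /andP[nt tn]] : exists n : nat, 2 ^- n.+1 < `|t| <= 2 ^- n.
  apply: dyadic_scale; rewrite ?normr_gt0// (le_trans tM)//.
  by rewrite invf_le1 ?exprn_gt0// exprn_ege1// ler1n.
have Mn : (M <= n)%N.
  rewrite leqNgt; apply/negP => nM.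
  have : 2 ^- M <= 2 ^- n.+1 :> R.
    by rewrite lef_pV2 ?posrE ?exprn_gt0// ler_weXn2l// ler1n.
  by rewrite leNgt (lt_le_trans nt tM).
have := hM2 n (leq_trans M2M Mn); rewrite /= mul1r => n2.
have {n2}[nx1 nx2] : 2 * 2 ^- n <= x /\ 2 * 2 ^- n <= 1 - x.
  have : 2 ^- n * 2 < Num.min x (1 - x) by rewrite -ltr_pdivlMr.
  by rewrite lt_min mulrC => /andP[/ltW ? /ltW ?].
have p0 : 0 < 2 ^+ n :> R by rewrite exprn_gt0.
have osc : `|h (t + x) - h x| <= 3 * (c ^+ n / 2 ^+ n).
  apply: (@dyadic_oscillation _ _ n) => //; first by rewrite addrK.
  move=> k kn kx; rewrite ler_pdivlMr// mulrC.
  by apply: hc => //; exact: leq_trans Mn.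
rewrite sub0r normrN /= [t *: 1]mulr1 normrZ normfV mulrC ler_pdivrMr ?normr_gt0//.
apply: (le_trans osc).
have cn : c ^+ n <= e / 6 by apply: hM1; exact: leq_trans Mn.
have n2t : 2 ^- n <= 2 * `|t|.
  by move: nt; rewrite exprS invfM mulrC ltr_pdivrMr// => /ltW; rewrite mulrC.
rewrite (@le_trans _ _ (3 * (e / 6 * (2 * `|t|))))//; last by lra.
rewrite ler_pM2l// ler_pM ?exprn_ge0 ?invr_ge0 ?(ltW p0)//.
Unshelve. all: by end_near.
Qed.

(** * Lipschitz norms and moments of the dyadic slopes *)

(** Positivity excludes the convention that 0 times infinity is 0, which would let a finite product
    hide an infinite Lipschitz norm. *)
Lemma mule_lty_gt0 (R : realType) (x y : \bar R) :
  (0 < x -> 0 < y -> x * y < +oo -> x < +oo /\ y < +oo)%E.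
Proof.
case: x => [x||] //; case: y => [y||] //= x0 y0.
- by rewrite !ltry.
- by rewrite gt0_muley.
- by rewrite gt0_mulye.
Qed.

Lemma lip_norm_ge (R : realType) (h : R -> R) (x y : R) :
  x \in `[0, 1] -> y \in `[0, 1] -> x != y ->
  ((`|h x - h y| / `|x - y|)%:E <= lip_norm h)%E.
Proof. by move=> x1 y1 xy; apply: ereal_sup_ubound; exists x, y. Qed.

Lemma lip_norm_gt0 (R : realType) (h : R -> R) :
  strictly_increasing01 h -> (0 < lip_norm h)%E.
Proof.
move=> hi.
have I0 : (0 : R) \in `[0, 1] by rewrite in_itv/= lexx ler01.
have I1 : (1 : R) \in `[0, 1] by rewrite in_itv/= lexx ler01.
have := lip_norm_ge _ h _ _ I1 I0 (oner_neq0 _); apply: lt_le_trans.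
by rewrite lte_fin divr_gt0// normr_gt0 subr_eq0 ?oner_neq0// gt_eqF// hi.
Qed.

(** Finiteness matters because [fine] sends [+oo] to 0. *)
Lemma lip_norm_le (R : realType) (h : R -> R) (x y : R) :
  (0 < lip_norm h < +oo)%E -> x \in `[0, 1] -> y \in `[0, 1] ->
  `|h x - h y| <= fine (lip_norm h) * `|x - y|.
Proof.
move=> hfin x1 y1; have [->|xy] := eqVneq x y; first by rewrite !subrr normr0 mulr0.
have fin : lip_norm h \is a fin_num by rewrite gt0_fin_numE; case/andP: hfin.
rewrite -ler_pdivrMr ?normr_gt0 ?subr_eq0// -lee_fin fineK//.
exact: lip_norm_ge.
Qed.

(* The increments of [h] at level [n.+1] are the images under [g0] and [g1] of
   the increments of [h0] and [h1] at level [n]. *)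
Lemma dyadic_moment_succ (R : realType) (h h0 h1 g0 g1 : R -> R)
    (L0 L1 s : R) (n : nat) :
  0 <= s -> 0 <= L0 -> 0 <= L1 -> increasing01 h ->
  unit_map h0 -> unit_map h1 -> increasing01 h0 -> increasing01 h1 ->
  (forall x, x \in `[0, 1] -> h (x / 2) = g0 (h0 x)) ->
  (forall x, x \in `[0, 1] -> h ((x + 1) / 2) = g1 (h1 x)) ->
  (forall x y, x \in `[0, 1] -> y \in `[0, 1] -> `|g0 x - g0 y| <= L0 * `|x - y|) ->
  (forall x y, x \in `[0, 1] -> y \in `[0, 1] -> `|g1 x - g1 y| <= L1 * `|x - y|) ->
  \sum_(k < 2 ^ n.+1) (2 ^+ n.+1 * dyadic_increment h n.+1 k) `^ s <=
    (2 * L0) `^ s * (\sum_(k < 2 ^ n) (2 ^+ n * dyadic_increment h0 n k) `^ s) +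
    (2 * L1) `^ s * (\sum_(k < 2 ^ n) (2 ^+ n * dyadic_increment h1 n k) `^ s).
Proof.
move=> s0 L00 L10 hi u0 u1 hi0 hi1 e0 e1 l0 l1.
have p0 m : 0 < 2 ^+ m :> R by rewrite exprn_gt0.
(* One term of the recursion: [gj] stretches by at most [L] while the dyadic length halves, so
   slopes grow by at most [2 * L]. *)
have step hj gj L (k' k : nat) : 0 <= L -> unit_map hj -> increasing01 hj ->
    (forall x y, x \in `[0, 1] -> y \in `[0, 1] -> `|gj x - gj y| <= L * `|x - y|) ->
    (k < 2 ^ n)%N -> (k' < 2 ^ n.+1)%N ->
    dyadic_increment h n.+1 k' = gj (hj (k.+1%:R / 2 ^+ n)) - gj (hj (k%:R / 2 ^+ n)) ->
    (2 ^+ n.+1 * dyadic_increment h n.+1 k') `^ s <=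
      (2 * L) `^ s * (2 ^+ n * dyadic_increment hj n k) `^ s.
  move=> Lge0 uj hij lj kn k'n E.
  have inc0 := dyadic_increment_ge0 _ hj n k hij kn.
  have inc0' := dyadic_increment_ge0 _ h n.+1 k' hi k'n.
  rewrite -powRM ?mulr_ge0 ?(ltW (p0 _))//.
  rewrite ge0_ler_powR ?nnegrE ?mulr_ge0 ?(ltW (p0 _))//.
  rewrite mulrACA -exprS ler_pM2l// E.
  have a01 := dyadic01 R n k (ltnW kn); have b01 := dyadic01 R n k.+1 kn.
  rewrite (le_trans (ler_norm _))// (le_trans (lj _ _ (uj _ b01) (uj _ a01)))//.
  by rewrite ger0_norm.
(* Indices below [2 ^ n] are the intervals in the left half of [0,1], governed by [g0]; indices
   [2 ^ n + k] are those in the right half, governed by [g1]. *)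
rewrite expnS mul2n -addnn big_split_ord !mulr_sumr/=.
apply: lerD; apply: ler_sum => k _; [apply: (step h0 g0)|apply: (step h1 g1)] => //.
- by rewrite (ltn_trans (ltn_ord k))// ltn_exp2l.
- rewrite /dyadic_increment -!e0 ?dyadic01 ?(ltnW (ltn_ord k))//.
  by rewrite exprSr invfM !mulrA.
- by rewrite expnS mul2n -addnn ltn_add2l.
- rewrite /dyadic_increment -!e1 ?dyadic01 ?(ltnW (ltn_ord k))//.
  have shift m : (2 ^ n + m)%:R / 2 ^+ n.+1 = (m%:R / 2 ^+ n + 1) / 2 :> R.
    rewrite natrD natrX exprS; field.
    by rewrite gt_eqF.
  by rewrite -addnS !shift.
Qed.

(* With [c ^ s = (1 + theta) / 2], Markov's inequality bounds the number of
   dyadic intervals of level [n] on which the slope of [h] exceeds [c ^ n];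
   by Borel-Cantelli almost every point is eventually far from them. *)
Lemma singular_of_moment (R : realType) (h : R -> R) (s theta K : R) :
  increasing01 h -> 0 < s -> 0 < theta < 1 ->
  (forall n, \sum_(k < 2 ^ n) (2 ^+ n * dyadic_increment h n k) `^ s <=
             K * (2 * theta) ^+ n) ->
  singular h.
Proof.
move=> hi s0 /andP[th0 th1] mom.
(* [eta] lies strictly between [theta] and 1: [theta / eta < 1] gives summability, and [eta < 1]
   gives [c < 1]. *)
pose eta := (1 + theta) / 2; pose c := eta `^ s^-1.
have eta0 : 0 < eta by rewrite /eta; lra.
have eta1 : eta < 1 by rewrite /eta; lra.
have c0 : 0 < c by rewrite powR_gt0.
have cs : c `^ s = eta by rewrite -powRrM mulVf ?gt_eqF// powRr1// ltW.
have c1 : c < 1.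
  rewrite ltNge; apply/negP => c1.
  have : 1 `^ s <= c `^ s.
    by rewrite ge0_ler_powR ?nnegrE ?(ltW s0) ?(ltW c0).
  by rewrite powR1 cs leNgt eta1.
have cns n : (c ^+ n) `^ s = eta ^+ n.
  by rewrite -powR_mulrn ?(ltW c0)// -powRrM mulrC powRrM cs powR_mulrn// ltW.
have p0 n : 0 < 2 ^+ n :> R by rewrite exprn_gt0.
pose bad n k := c ^+ n < 2 ^+ n * dyadic_increment h n k.
pose I n k : set R := [set` `[(k%:R - 1) / 2 ^+ n, (k%:R + 2) / 2 ^+ n]].
pose A n k : set R := if bad n k then I n k else set0.
pose U n := \big[setU/set0]_(k < 2 ^ n) A n k.
have mA n k : measurable (A n k) by rewrite /A; case: ifP => _; [exact: measurable_itv|].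
have mU n : measurable (U n) by apply: bigsetU_measurable => k _.
(* Markov's inequality termwise: the enlarged interval has length [3 / 2 ^+ n], and on a bad index
   the remaining factor is at least 1. *)
have muA n k : (k < 2 ^ n)%N ->
    (lebesgue_measure (A n k) <=
     (3 / 2 ^+ n * ((2 ^+ n * dyadic_increment h n k) `^ s / eta ^+ n))%:E)%E.
  move=> kn; have e0 : 0 < eta ^+ n by rewrite exprn_gt0.
  rewrite /A; case: ifPn => [badk|_]; last first.
    by rewrite measure0 lee_fin mulr_ge0 ?divr_ge0 ?powR_ge0 ?(ltW e0) ?(ltW (p0 _)).
  have lt12 : (k%:R - 1) / 2 ^+ n < (k%:R + 2) / 2 ^+ n :> R.
    by rewrite ltr_pM2r ?invr_gt0//; lra.
  rewrite /I lebesgue_measure_itv/= lte_fin lt12 -EFinB lee_fin -mulrBl.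
  rewrite (_ : k%:R + 2 - (k%:R - 1) = 3 :> R); last by ring.
  rewrite ler_peMr ?divr_ge0 ?(ltW (p0 _))// ler_pdivlMr// mul1r -cns.
  have cn0 := exprn_ge0 n (ltW c0).
  rewrite ge0_ler_powR ?nnegrE ?(ltW s0)//; last exact: ltW.
  by rewrite (le_trans cn0)// ltW.
(* The number [2 ^ n] of intervals, present in the moment bound, cancels against their length. *)
have muU n : (lebesgue_measure (U n) <= (geometric (3 * K) (theta / eta) n)%:E)%E.
  apply: (le_trans (Boole_inequality _ _)) => [k _|]; first exact: mA.
  apply: (@le_trans _ _ (\sum_(k < 2 ^ n)
      (3 / 2 ^+ n * ((2 ^+ n * dyadic_increment h n k) `^ s / eta ^+ n))%:E)%E).
    by apply: lee_sum => k _; exact: muA.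
  rewrite sumEFin lee_fin -mulr_sumr -mulr_suml /geometric/=.
  have e0 : 0 < eta ^+ n by rewrite exprn_gt0.
  rewrite mulrA ler_pdivrMr// exprMn exprVn -!mulrA mulVf ?gt_eqF// mulr1.
  rewrite ler_pM2l// mulrC ler_pdivrMr//.
  apply: (le_trans (mom n)); rewrite exprMn le_eqVlt; apply/orP; left; apply/eqP.
  by ring.
have K0 : 0 <= K.
  have := mom 0%N; rewrite expr0 mulr1; apply: le_trans.
  by apply: sumr_ge0 => k _; exact: powR_ge0.
have q0 : 0 < theta / eta by rewrite divr_gt0.
have q1 : `|theta / eta| < 1.
  by rewrite gtr0_norm// ltr_pdivrMr// mul1r /eta; lra.
have muU_fin : (\sum_(0 <= n <oo) lebesgue_measure (U n) < +oo)%E.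
  apply: (@le_lt_trans _ _ (\sum_(0 <= n <oo) (geometric (3 * K) (theta / eta) n)%:E)%E).
    apply: lee_nneseries => [n _ _|n _]; first exact: measure_ge0.
    exact: muU.
  rewrite (_ : (fun _ => _) = EFin \o series (geometric (3 * K) (theta / eta))).
    by rewrite EFin_lim ?ltry//; exact: is_cvg_geometric_series.
  by apply/funext => n /=; rewrite sumEFin.
exists (lim_sup_set U); split.
- apply: bigcapT_measurable => n; apply: bigcup_measurable => j _; exact: mU.
- exact: lim_sup_set_cvg0.
(* If [x] avoids every [U n] with [n >= N], then [N] serves as the threshold in
   [derive0_of_dyadic]. *)
move=> x /= /not_implyP[x01 ndx] N _.
apply: contra_notP ndx => nU; apply: (@derive0_of_dyadic _ _ c _ N) => //.
  by rewrite c1 ltW.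
move=> n Nn k kn kx; rewrite leNgt; apply/negP => badk.
apply: nU; exists n => //.
rewrite /U -bigcup_mkord; exists k => //=.
by rewrite /A /bad badk /I/= in_itv.
Qed.

(** * Moment bound for the solution of the functional equations *)

Theorem theorem5p1 (R : realType) (phi : R -> R)
    (f g : 'I_2 -> 'I_2 -> R -> R) (vphi : 'I_2 -> R -> R)
    (hphi : comparison_function phi)
    (hf0 : forall x : R, x \in `[0, 1] -> f 0 0 x = x / 2 /\ f 1 0 x = x / 2)
    (hf1 : forall x : R, x \in `[0, 1] ->
       f 0 1 x = (x + 1) / 2 /\ f 1 1 x = (x + 1) / 2)
    (hf : forall i j : 'I_2, phi_contraction phi (f i j))
    (hg : forall i : 'I_2, compatible_system phi (g i 0) (g i 1))
    (vphi_map : forall i : 'I_2, unit_map (vphi i))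
    (vphi_incr : forall i : 'I_2, increasing01 (vphi i))
    (vphi_cont : forall i : 'I_2, {within `[0, 1], continuous (vphi i)})
    (vphi_eq : forall (i j : 'I_2) (x : R), x \in `[0, 1] ->
       g i j (vphi j x) = vphi i (f i j x))
    (hlip : (\prod_(i < 2) \prod_(j < 2) lip_norm (g i j) < (1 / 16)%:E)%E) :
  singular (vphi 0) /\ singular (vphi 1).
Proof.
have ord1 : lift ord0 ord0 = 1 :> 'I_2 by apply/val_inj.
have cases i : i = 0 \/ i = 1 :> 'I_2.
  by case: i => [[|[|]]]//= ?; [left|right]; exact/val_inj.
have L0 i j : (0 < lip_norm (g i j))%E.
  apply: lip_norm_gt0; have [[? _] [? _] _] := hg i.
  by have [->|->] := cases j.
have hprod : (lip_norm (g 0%R 0%R) * lip_norm (g 0%R 1%R) *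
    (lip_norm (g 1%R 0%R) * lip_norm (g 1%R 1%R)) < (1 / 16)%:E)%E.
  by move: hlip; rewrite !big_ord_recl !big_ord0 !mule1 ord1.
have Lfin i j : (0 < lip_norm (g i j) < +oo)%E.
  rewrite L0/=.
  have [] := mule_lty_gt0 _ _ _ _ _ (lt_trans hprod (ltry _)); rewrite ?mule_gt0//.
  move=> /mule_lty_gt0[]// ? ? /mule_lty_gt0[]// ? ?.
  by have [->|->] := cases i; have [->|->] := cases j.
pose L i j := fine (lip_norm (g i j)).
have LE i j : lip_norm (g i j) = (L i j)%:E.
  by rewrite fineK// gt0_fin_numE//; case/andP: (Lfin i j).
have Lpos i j : 0 < L i j by rewrite -lte_fin -LE.
(* As 16 is the fourth power of 2, each of the four norms absorbs one factor 2. *)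
have {}hprod : \prod_(i < 2) \prod_(j < 2) (2 * L i j) < 1.
  rewrite !big_ord_recl !big_ord0 !mulr1 ord1.
  by move: hprod; rewrite !LE -!EFinM lte_fin; lra.
have twoL i j : 0 < 2 * L i j by rewrite mulr_gt0.
have [s [theta [v [s0 th01 v0 sub]]]] := subeigenvector R _ twoL hprod.
pose Q (i : 'I_2) (n : nat) := \sum_(k < 2 ^ n) (2 ^+ n * dyadic_increment (vphi i) n k) `^ s.
have Qsucc i n : Q i n.+1 <= \sum_(j < 2) (2 * L i j) `^ s * Q j n.
  rewrite !big_ord_recl big_ord0 addr0 ord1.
  have glip j x y := lip_norm_le R (g i j) x y (Lfin i j).
  apply: (@dyadic_moment_succ _ _ _ _ (g i 0) (g i 1)) => //;
    rewrite ?(ltW s0) ?(ltW (Lpos _ _))//.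
  - move=> x x01; rewrite vphi_eq//; have [h1 h2] := hf0 x x01.
    by have [->|->] := cases i; rewrite ?h1 ?h2.
  - move=> x x01; rewrite vphi_eq//; have [h1 h2] := hf1 x x01.
    by have [->|->] := cases i; rewrite ?h1 ?h2.
  - by move=> x y; exact: glip.
  - by move=> x y; exact: glip.
(* This choice makes [K * v i >= 1] for both [i], which covers level 0, where the only increment
   lies between 0 and 1. *)
pose K := (v 0)^-1 + (v 1)^-1.
have th0 : 0 < theta by case/andP: th01.
have Q0 i : Q i 0%N <= K * v i.
  rewrite /Q big_ord_recl big_ord0 addr0 expr0 mul1r.
  apply: (@le_trans _ _ 1).
    have I0 := dyadic01 R 0 0 isT; have I1 := dyadic01 R 0 1 isT.
    have d0 : 0 <= dyadic_increment (vphi i) 0 0 by exact: dyadic_increment_ge0.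
    have d1 : dyadic_increment (vphi i) 0 0 <= 1.
      rewrite /dyadic_increment.
      by have := vphi_map i _ I0; have := vphi_map i _ I1; rewrite !in_itv/=; lra.
    rewrite (_ : 1 = 1 `^ s :> R); last by rewrite powR1.
    by rewrite ge0_ler_powR ?nnegrE ?(ltW s0).
  rewrite -[leLHS](@mulVf _ (v i)) ?gt_eqF// ler_pM2r//.
  by have [->|->] := cases i; rewrite ?lerDl ?lerDr invr_ge0 ltW.
(* Both indices are bounded at once: the recursion mixes [Q 0] and [Q 1], and the weights [v] are
   reproduced up to the factor [2 * theta]. *)
have Qn n : forall i, Q i n <= K * v i * (2 * theta) ^+ n.
  elim: n => [|n IH] i; first by rewrite expr0 mulr1.
  apply: (le_trans (Qsucc i n)).
  apply: (@le_trans _ _ (K * (2 * theta) ^+ n * \sum_(j < 2) (2 * L i j) `^ s * v j)).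
    rewrite mulr_sumr; apply: ler_sum => j _.
    rewrite mulrCA ler_wpM2l ?powR_ge0// mulrAC; exact: IH.
  have K0 : 0 <= K by rewrite addr_ge0// invr_ge0 ltW.
  rewrite exprSr [leRHS](_ : _ = K * (2 * theta) ^+ n * (2 * theta * v i)); last by ring.
  by rewrite ler_wpM2l// mulr_ge0// exprn_ge0// mulr_ge0// ltW.
split; apply: singular_of_moment s0 th01 (fun n => Qn n _) => //.
Qed.
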